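(* Let $p$ and $q$ be integers with $p\ge 1$ and $0\le q\le p-1$, and let $t$ be an odd integer. If $\mathcal{H}$ is a $k$-uniform hypergraph (for some $k\ge 2$), then $\mathcal{E}(\mathcal{H})\neq \sqrt[p]{2^q t}$.
   Context: A hypergraph $\mathcal{H}=(V,E)$ consists of a finite vertex set $V$ and a set $E$ of edges, each edge being a subset of $V$ of cardinality at least $2$ (distinct edges are distinct subsets). It is $k$-uniform if every edge has exactly $k$ vertices. For $i\neq j$ in $V$, $d(\{i,j\})$ denotes the number of edges containing both $i$ and $j$. The adjacency matrix $\mathbf{A}(\mathcal{H})$ is the $|V|\times|V|$ matrix with zero diagonal and $(i,j)$ entry $d(\{i,j\})$ for $i\neq j$. The (adjacency) energy is $\mathcal{E}(\mathcal{H})=\sum_{i=1}^{n}|\lambda_i|$, where $\lambda_1,\dots,\lambda_n$ are the eigenvalues of $\mathbf{A}(\mathcal{H})$ (with multiplicity). *)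

(* Defs.v *)
From mathcomp Require Import all_boot all_order all_algebra.
Set Implicit Arguments.
Unset Strict Implicit.
Unset Printing Implicit Defensive.
Import Order.TTheory GRing.Theory Num.Theory.
Local Open Scope ring_scope.

Record hypergraph (V : finType) := Hypergraph {
  edges : {set {set V}};
  edge_card_ge2 : forall e : {set V}, e \in edges -> (2 <= #|e|)%N
}.

Definition uniform (V : finType) (k : nat) (H : hypergraph V) : Prop :=
  forall e : {set V}, e \in edges H -> #|e| = k.

Definition codegree (V : finType) (H : hypergraph V) (u v : V) : nat :=
  #|[set e in edges H | (u \in e) && (v \in e)]|.

(* Rows and columns are indexed by the enumeration of V. *)
Definition adjacency (R : pzSemiRingType) (V : finType) (H : hypergraph V) :
    'M[R]_#|V| :=
  \matrix_(i, j)
    (if i == j then 0 else (codegree H (enum_val i) (enum_val j))%:R).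

(* The roots of the characteristic polynomial, repeated according to
   multiplicity, in an arbitrary order. *)
Definition eigenvalues (C : numClosedFieldType) (n : nat) (A : 'M[C]_n) :
    seq C :=
  sval (closed_field_poly_normal (char_poly A)).

Lemma eigenvaluesE (C : numClosedFieldType) (n : nat) (A : 'M[C]_n) :
  char_poly A = \prod_(z <- eigenvalues A) ('X - z%:P).
Proof.
rewrite /eigenvalues; case: closed_field_poly_normal => r /= {1}->.
by rewrite (monicP (char_poly_monic A)) scale1r.
Qed.

Definition energy (C : numClosedFieldType) (V : finType) (H : hypergraph V) :
    C :=
  \sum_(z <- eigenvalues (adjacency C H)) `|z|.

(* For a < 0 and p odd, [p.-root a] is not the real p-th root of a (it has
   minimal nonnegative argument), so the real one is taken explicitly.  For
   a < 0 and p even no real root exists and [p.-root a] is a complex root. *)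
Definition radical (C : numClosedFieldType) (p : nat) (a : C) : C :=
  if (a < 0) && odd p then - p.-root (- a) else p.-root a.

Lemma radicalK (C : numClosedFieldType) (p : nat) (a : C) :
  (0 < p)%N -> radical p a ^+ p = a.
Proof.
move=> p_gt0; rewrite /radical; case: ifP => [/andP[_ p_odd]|_].
  by rewrite exprNn -signr_odd p_odd expr1 rootCK // mulN1r opprK.
by rewrite rootCK.
Qed.

Lemma radical_ge0 (C : numClosedFieldType) (p : nat) (a : C) :
  (0 < p)%N -> 0 <= a -> 0 <= radical p a.
Proof.
by move=> p_gt0 a_ge0; rewrite /radical le_gtF //= rootC_ge0.
Qed.

(* Main.v *)
Require Import Defs.
From mathcomp Require Import all_boot all_order all_algebra.
From mathcomp Require Import all_field.
Set Implicit Arguments.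
Unset Strict Implicit.
Unset Printing Implicit Defensive.
Import Order.TTheory GRing.Theory Num.Theory.
Local Open Scope ring_scope.

(* The adjacency matrix is real symmetric with zero trace, so the energy is
   2 s, where s is the sum of the positive eigenvalues, an algebraic integer.
   If (2 s)^p = 2^q t with q < p, then 2^(p-q-1) s^p = t / 2 is a rational
   algebraic integer, hence an integer, and t is even. *)

Lemma integral_exp (R K : comNzRingType) (f : {rmorphism R -> K}) u n :
  integralOver f u -> integralOver f (u ^+ n).
Proof.
move=> int_u; elim: n => [|n IHn]; first exact: integral1.
by rewrite exprS; apply: integral_mul.
Qed.

(* A root in C of an integer polynomial that happens to be rational is also a
   root in algC, where rational algebraic integers are known to be integers. *)
Lemma integral_rat_int (C : numClosedFieldType) (a : rat) :
  integralOver (intr : int -> C) (ratr a) -> a \is a Num.int.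
Proof.
case=> p p_monic.
(* The embedding of [int] in [C] factors through [rat], and field morphisms reflect roots, so [a] is
   already a root over [rat]. *)
rewrite -(eq_map_poly (ratr_int C)) (map_poly_comp (ratr : rat -> C)).
rewrite fmorph_root => pa0.
have int_a : (ratr a : algC) \in Aint.
  apply: (@root_monic_Aint (map_poly intr p)); last 2 first.
  - exact: monic_map.
  - by apply/polyOverP=> i; rewrite coef_map /= rpred_int.
  rewrite -(eq_map_poly (ratr_int algC)) (map_poly_comp (ratr : rat -> algC)).
  by rewrite fmorph_root.
by rewrite -Cint_rat Cint_rat_Aint // Crat_rat.
Qed.

(** With [w] the conjugate transpose of a row eigenvector [v], computing [v A w] in two ways gives
    [z (v w) = z^* (v w)]; moreover [v w], a sum of squared moduli, vanishes only if [v = 0]. *)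
Lemma hermitian_eigenvalue_real (C : numClosedFieldType) n (A : 'M[C]_n) z :
  map_mx Num.conj A^T = A -> eigenvalue A z -> z \is Num.real.
Proof.
move=> hermA /eigenvalueP[v vA v_neq0].
pose w := map_mx Num.conj v^T.
have Aw : A *m w = z^* *: w.
  by rewrite -hermA /w -map_mxM -trmx_mul vA linearZ map_mxZ.
have /matrixP/(_ 0 0) : z *: (v *m w) = z^* *: (v *m w).
  by rewrite scalemxAl -vA -mulmxA Aw scalemxAr.
rewrite !mxE => /eqP; rewrite -subr_eq0 -mulrBl mulf_eq0 subr_eq0 CrealE eq_sym.
case/orP=> // vw0; case/negP: v_neq0; apply/eqP/rowP=> j.
move: vw0; rewrite psumr_eq0 => [/allP/(_ j)|i _]; last first.
  by rewrite !mxE mul_conjC_ge0.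
by rewrite mem_index_enum !mxE mul_conjC_eq0 => /(_ isT)/eqP.
Qed.

(** Both sides are, up to sign, the subleading coefficient of [char_poly A]. There is none for
    [n = 0], where both sides are empty sums. *)
Lemma sum_eigenvalues (C : numClosedFieldType) n (A : 'M[C]_n) :
  \sum_(z <- eigenvalues A) z = \tr A.
Proof.
have size_ev : size (eigenvalues A) = n.
  apply/succn_inj.
  by rewrite -(size_prod_XsubC _ id) -eigenvaluesE size_char_poly.
case: n A size_ev => [|n] A size_ev.
  by rewrite (size0nil size_ev) big_nil /mxtrace big_ord0.
apply: oppr_inj; rewrite -coefPn_prod_XsubC ?size_ev // -eigenvaluesE.
by rewrite char_poly_trace.
Qed.

Lemma mem_eigenvalues (C : numClosedFieldType) n (A : 'M[C]_n) z :
  (z \in eigenvalues A) = eigenvalue A z.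
Proof. by rewrite eigenvalue_root_char eigenvaluesE root_prod_XsubC. Qed.

Lemma integral_eigenvalue (C : numClosedFieldType) n (A : 'M[int]_n) (z : C) :
  eigenvalue (map_mx intr A) z -> integralOver (intr : int -> C) z.
Proof.
rewrite eigenvalue_root_char -map_char_poly.
by exists (char_poly A); first exact: char_poly_monic.
Qed.

Section AdjacencySpectrum.

Variables (C : numClosedFieldType) (V : finType) (H : hypergraph V).
Local Notation A := (adjacency C H).

Lemma map_adjacency : map_mx intr (adjacency int H) = A.
Proof. by apply/matrixP=> i j; rewrite !mxE; case: ifP; rewrite ?rmorph_nat. Qed.

Lemma mxtrace_adjacency : \tr A = 0.
Proof. by apply: big1 => i _; rewrite mxE eqxx. Qed.

Lemma hermitian_adjacency : map_mx Num.conj A^T = A.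
Proof.
apply/matrixP=> i j; rewrite !mxE eq_sym; case: ifP => _; rewrite ?rmorph0 //.
by rewrite rmorph_nat /codegree; under eq_finset do rewrite [X in _ && X]andbC.
Qed.

Lemma half_energy_integral :
  exists2 s : C, energy C H = 2 * s & integralOver (intr : int -> C) s.
Proof.
(* |z| + z = 2 max(z, 0) for real z, and the eigenvalues z sum to 0. *)
exists (\sum_(z <- eigenvalues A) Num.max z 0).
  rewrite mulr_sumr -[LHS]addr0 -{1}mxtrace_adjacency -sum_eigenvalues.
  rewrite /energy -big_split /=.
  apply: eq_big_seq => z; rewrite mem_eigenvalues.
  move=> /(hermitian_eigenvalue_real hermitian_adjacency).
  rewrite realE => /orP[z_ge0|z_le0] /=.
    by rewrite ger0_norm // max_l // mulr_natl mulr2n.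
  by rewrite ler0_norm // max_r // mulr0 addNr.
(* Each summand is 0 or an eigenvalue of an integer matrix, and integral elements are closed under
   addition. *)
rewrite big_seq; apply: big_ind; first exact: integral0.
  exact: integral_add.
move=> z; rewrite mem_eigenvalues -map_adjacency => /integral_eigenvalue int_z.
by rewrite maxEle; case: ifP => _; [exact: integral0|].
Qed.

End AdjacencySpectrum.

Theorem theorem9 (C : numClosedFieldType) (p q : nat) (t : int)
    (hp : (1 <= p)%N) (hq : (q <= p - 1)%N) (ht : odd `|t|%N)
    (V : finType) (H : hypergraph V) (k : nat) (hk : (2 <= k)%N)
    (hH : uniform k H) :
  energy C H <> radical p (2%:R ^+ q * t%:~R).
Proof.
have [s -> int_s] := half_energy_integral C H.
move=> /(congr1 (fun x => x ^+ p)); rewrite radicalK // exprMn.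
have lt_qp : (q < p)%N by rewrite -(subnK hp) addn1 ltnS.
(* Cancelling [2 ^ q] leaves [2 ^ (p - q) * s ^ p = t]; as [q < p], one more factor 2 splits off, so
   [2 * x = t]. *)
rewrite -{1}(subnKC (ltnW lt_qp)) exprD -mulrA.
move/(mulfI (expf_neq0 _ _)); rewrite pnatr_eq0 => /(_ isT).
rewrite -(prednK (n := p - q)) ?subn_gt0 // exprS -mulrA.
set x := _ * s ^+ p => def_t.
have int_x : integralOver (intr : int -> C) x.
  by apply: integral_mul; apply: integral_exp => //; apply: integral_nat.
have x_rat : x = ratr (t%:~R / 2).
  by rewrite fmorph_div /= ratr_int rmorph_nat -def_t mulrC mulKf // pnatr_eq0.
move: int_x; rewrite x_rat => /integral_rat_int/intrP[m] def_m.
have def_t2 : t = m * 2.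
  by apply: (@intr_inj rat); rewrite intrM -def_m divfK.
by move: ht; rewrite def_t2 abszM oddM andbF.
Qed.
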